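(* Let $\gamma:I\to M^3$ be an arc length parametrized Frenet curve in a connected orientable Riemannian $3$-manifold, with Frenet frame $\{T,N,B\}$, curvature $\kappa$ and torsion $\tau$, and let $\mathcal V$ be a torse-forming vector field along $\gamma$ with potential function $f$, not parallel along $\gamma$. Then $\gamma$ is a PA curve with $(\mathcal V,\frac{\pi}{2})$ if and only if there are a choice of sign $\pm$ and a constant $r\in\mathbb R$ such that $$\mathcal V=(\tanh p)\,T\pm(\operatorname{sech}p)\,B,\qquad p(s):=\int^s f(u)\,du+r,$$ where $\int^s f(u)\,du$ denotes a fixed antiderivative of $f$ along $\gamma$. In addition, in this case the ratio of the curvatures of $\gamma$ is $$\frac{\tau}{\kappa}=\pm\sinh p$$ (with the same sign as in the expression for $\mathcal V$), and in particular this ratio is nonconstant.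
   Context: $\nabla$ is the Levi-Civita connection, $I\subset\mathbb R$ an interval. Frenet curve in $M^3$: a smooth curve with $\gamma',\nabla_{\gamma'}\gamma',\nabla_{\gamma'}^2\gamma'$ linearly independent along $I$. When parametrized by arc length it has a positively oriented orthonormal Frenet frame $\{T=\gamma',N,B\}$ and curvatures $\kappa=\kappa_1>0$, $\tau=\kappa_2>0$ with $\nabla_TT=\kappa N$, $\nabla_TN=-\kappa T+\tau B$, $\nabla_TB=-\tau N$. Torse-forming along $\gamma$: $\mathcal V$ is torse-forming along $\gamma$ with potential function $f$ and generating form $\omega$ if $\nabla_T\mathcal V=fT+\omega(T)\mathcal V$, where $f,\omega(T)$ are smooth functions on $I$. Parallel along $\gamma$ means $\nabla_T\mathcal V=0$ identically. PA (prescribed angle) curve: for a nowhere zero vector field $\mathcal V$ along $\gamma$ and a smooth $\theta:I\to[0,\pi]$, $\gamma$ is a PA curve with $(\mathcal V,\theta)$ if $\mathcal V$ has unit length along $\gamma$ and $\cos\theta=\langle\mathcal V,N\rangle$. Thus $(\mathcal V,\frac{\pi}{2})$ means $|\mathcal V|=1$ and $\langle\mathcal V,N\rangle=0$. *)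

(* Defs.v *)
From HB Require Import structures.
From mathcomp Require Import all_boot all_order all_algebra.
From mathcomp Require Import all_classical all_reals all_analysis.
Set Implicit Arguments.
Unset Strict Implicit.
Unset Printing Implicit Defensive.
Import Order.TTheory GRing.Theory Num.Theory.
Import numFieldNormedType.Exports.
Local Open Scope classical_set_scope.
Local Open Scope ring_scope.

(* Riemannian 3-manifolds are given by an arbitrary atlas.  Coordinate and
   tangent vectors are row vectors, so that a Jacobian acts on the right and
   its row a is the derivative in the direction of the a-th coordinate. *)

Section hyperbolic.
Context {R : realType}.
Implicit Type x : R.

Definition sinh x := (expR x - expR (- x)) / 2.
Definition cosh x := (expR x + expR (- x)) / 2.
Definition tanh x := sinh x / cosh x.
Definition sech x := (cosh x)^-1.

End hyperbolic.

Section one_variable.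
Context {R : realType} {W : normedModType R}.
Implicit Types (I J : set R) (f : R -> W).

(* The derivative relative to I: one-sided at an endpoint belonging to I. *)
Definition has_deriv I f (s : R) (l : W) : Prop :=
  (fun t : R => (t - s)^-1 *: (f t - f s)) @ within I s^' --> l.

Definition deriv I f (s : R) : W :=
  lim ((fun t : R => (t - s)^-1 *: (f t - f s)) @ within I s^').

(* J is meant to be relatively open in I; values of f outside J are junk. *)
Definition smooth_on I J f : Prop :=
  forall (k : nat) (s : R), J s ->
    exists l : W, has_deriv I (iter k (deriv I) f) s l.

End one_variable.

Section several_variables.
Context {R : realType} {W : normedModType R}.
Implicit Types (U : set 'rV[R]_3) (f : 'rV[R]_3 -> W).

Definition basis_vec (a : 'I_3) : 'rV[R]_3 := delta_mx 0 a.

Definition partial (a : 'I_3) f (x : 'rV[R]_3) : W := 'D_(basis_vec a) f x.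

Fixpoint class_C (k : nat) U f : Prop :=
  match k with
  | 0 => forall x, U x -> {for x, continuous f}
  | k'.+1 => (forall x, U x -> differentiable f x) /\
             (forall a : 'I_3, class_C k' U (partial a f))
  end.

Definition smooth_map U f : Prop := forall k : nat, class_C k U f.

End several_variables.

Record manifold3 (R : realType) (M : topologicalType) := Manifold3 {
  chart : Type;
  dom : chart -> set M;
  chart_map : chart -> M -> 'rV[R]_3;
  chart_inv : chart -> 'rV[R]_3 -> M;
  manifold_hausdorff : hausdorff_space M;
  manifold_second_countable : @second_countable M;
  dom_cover : forall p : M, exists i, dom i p;
  dom_open : forall i, open (dom i);
  img_open : forall i, open (chart_map i @` dom i);
  chart_mapK : forall i p, dom i p -> chart_inv i (chart_map i p) = p;
  chart_map_continuous : forall i p, dom i p ->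
    {for p, continuous (chart_map i)};
  chart_inv_continuous : forall i x, (chart_map i @` dom i) x ->
    {for x, continuous (chart_inv i)};
  transition_smooth : forall i j,
    smooth_map (chart_map i @` (dom i `&` dom j)) (chart_map j \o chart_inv i)
}.

Section tensors.
Context {R : realType} {M : topologicalType} (A : manifold3 R M).

Definition transition (i j : chart A) : 'rV[R]_3 -> 'rV[R]_3 :=
  chart_map j \o chart_inv i.

Definition tjac (i j : chart A) (p : M) : 'M[R]_3 :=
  jacobian (transition i j) (chart_map i p).

(* The coefficients of the metric in the chart i, as functions of the
   coordinates. *)
Record riemannian_metric := RiemannianMetric {
  gram : chart A -> 'rV[R]_3 -> 'M[R]_3;
  gram_smooth : forall i, smooth_map (chart_map i @` dom i) (gram i);
  gram_sym : forall i x, (chart_map i @` dom i) x -> (gram i x)^T = gram i x;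
  gram_pos : forall i x (v : 'rV[R]_3), (chart_map i @` dom i) x -> v != 0 ->
    0 < (v *m gram i x *m v^T) 0 0;
  gram_compat : forall i j p, dom i p -> dom j p ->
    gram i (chart_map i p) =
      tjac i j p *m gram j (chart_map j p) *m (tjac i j p)^T
}.

(* A continuous choice of an orientation of every tangent space: orsign i p is
   1 or -1 according to whether the coordinate basis of the chart i at p is
   positive or negative. *)
Record orientation := Orientation {
  orsign : chart A -> M -> R;
  orsign_val : forall i p, dom i p -> orsign i p = 1 \/ orsign i p = -1;
  orsign_continuous : forall i p, dom i p -> {for p, continuous (orsign i)};
  orsign_compat : forall i j p, dom i p -> dom j p ->
    0 < orsign i p * orsign j p * \det (tjac i j p)
}.

(* christoffel i x a b is the coordinate vector of the covariant derivative of
   the b-th coordinate field in the direction of the a-th one. *)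
Record affine_connection := AffineConnection {
  christoffel : chart A -> 'rV[R]_3 -> 'I_3 -> 'I_3 -> 'rV[R]_3;
  christoffel_smooth : forall i a b,
    smooth_map (chart_map i @` dom i) (fun x => christoffel i x a b);
  christoffel_compat : forall i j p (a b : 'I_3), dom i p -> dom j p ->
    christoffel i (chart_map i p) a b *m tjac i j p =
      partial a (partial b (transition i j)) (chart_map i p) +
      \sum_(c < 3) \sum_(d < 3) (tjac i j p a c * tjac i j p b d) *:
        christoffel j (chart_map j p) c d
}.

Definition torsion_free (D : affine_connection) : Prop :=
  forall i x (a b : 'I_3), (chart_map i @` dom i) x ->
    christoffel D i x a b = christoffel D i x b a.

Definition metric_connection (g : riemannian_metric) (D : affine_connection) :
    Prop :=
  forall i x (a b c : 'I_3), (chart_map i @` dom i) x ->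
    partial c (fun y => gram g i y a b) x =
      \sum_(d < 3) (christoffel D i x c a 0 d * gram g i x d b +
                    christoffel D i x c b 0 d * gram g i x a d).

Definition levi_civita (g : riemannian_metric) (D : affine_connection) : Prop :=
  torsion_free D /\ metric_connection g D.

End tensors.

Section curves.
Context {R : realType} {M : topologicalType} {A : manifold3 R M}.
Variables (g : riemannian_metric A) (o : orientation A)
  (D : affine_connection A).
Variables (I : set R) (gam : R -> M).

Definition interval_set : Prop :=
  is_interval I /\ exists a b : R, [/\ I a, I b & a < b].

Definition chart_times (i : chart A) : set R :=
  [set s | I s /\ dom i (gam s)].

Definition smooth_curve : Prop :=
  {within I, continuous gam} /\
  forall i, smooth_on I (chart_times i) (chart_map i \o gam).

(* Components in every chart of a vector field along gam; only the values
   V i s with s in chart_times i are meaningful. *)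
Definition along : Type := chart A -> R -> 'rV[R]_3.
Implicit Types V W N B : along.

Definition vector_field_along V : Prop :=
  (forall i, smooth_on I (chart_times i) (V i)) /\
  (forall i j s, chart_times i s -> chart_times j s ->
    V j s = V i s *m tjac i j (gam s)).

Definition velocity : along := fun i => deriv I (chart_map i \o gam).

Definition cov V : along := fun i s =>
  deriv I (V i) s +
  \sum_(a < 3) \sum_(b < 3) (velocity i s 0 a * V i s 0 b) *:
    christoffel D i (chart_map i (gam s)) a b.

Definition dot (i : chart A) (s : R) V W : R :=
  (V i s *m gram g i (chart_map i (gam s)) *m (W i s)^T) 0 0.

Definition norm (i : chart A) (s : R) V : R := Num.sqrt (dot i s V V).

Definition arc_length_param : Prop :=
  forall i s, chart_times i s -> norm i s velocity = 1.

Definition frenet_curve : Prop :=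
  smooth_curve /\
  forall i s, chart_times i s ->
    free [:: velocity i s; cov velocity i s; cov (cov velocity) i s].

Definition orthonormal_frame V W B : Prop :=
  forall i s, chart_times i s ->
    [/\ dot i s V V = 1, dot i s W W = 1 & dot i s B B = 1] /\
    [/\ dot i s V W = 0, dot i s V B = 0 & dot i s W B = 0].

Definition positive_frame V W B : Prop :=
  forall i s, chart_times i s ->
    0 < orsign o i (gam s) *
        \det (\matrix_(a < 3) nth 0 [:: V i s; W i s; B i s] a).

Definition frenet_frame N B (kappa tau : R -> R) : Prop :=
  [/\ vector_field_along N /\ vector_field_along B,
      orthonormal_frame velocity N B /\ positive_frame velocity N B,
      smooth_on I I kappa /\ smooth_on I I tau,
      forall s, I s -> 0 < kappa s /\ 0 < tau s
    & forall i s, chart_times i s ->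
        [/\ cov velocity i s = kappa s *: N i s,
            cov N i s = - kappa s *: velocity i s + tau s *: B i s
          & cov B i s = - tau s *: N i s]].

(* w is the function omega(T), where omega is the generating form. *)
Definition torse_forming V (f : R -> R) : Prop :=
  smooth_on I I f /\
  exists w : R -> R, smooth_on I I w /\
    forall i s, chart_times i s ->
      cov V i s = f s *: velocity i s + w s *: V i s.

Definition parallel V : Prop :=
  forall i s, chart_times i s -> cov V i s = 0.

Definition nowhere_zero V : Prop :=
  forall i s, chart_times i s -> V i s != 0.

(* N is the principal normal of gam. *)
Definition PA_curve N V (theta : R -> R) : Prop :=
  [/\ nowhere_zero V,
      smooth_on I I theta /\ (forall s, I s -> 0 <= theta s <= pi),
      forall i s, chart_times i s -> norm i s V = 1
    & forall i s, chart_times i s -> cos (theta s) = dot i s V N].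

Definition antiderivative (f F : R -> R) : Prop :=
  forall s, I s -> has_deriv I F s (f s).

(* sg = false stands for the sign +, and sg = true for the sign -. *)
Definition tanh_sech_form V B (sg : bool) (p : R -> R) : Prop :=
  forall i s, chart_times i s ->
    V i s = tanh (p s) *: velocity i s + ((-1) ^+ sg * sech (p s)) *: B i s.

End curves.

(* Main.v *)
Require Import Defs.
From mathcomp Require Import all_boot all_order all_algebra.
From mathcomp Require Import all_classical all_reals all_analysis.
From mathcomp Require Import ring lra.
Import Order.TTheory GRing.Theory Num.Theory.
Import numFieldNormedType.Exports.
Local Open Scope classical_set_scope.
Local Open Scope ring_scope.

(** Write a = <V,T>, n = <V,N>, b = <V,B>.  The connection being metric, scalar
    products of fields along the curve obey the product rule ([inner_deriv]),
    so the Frenet equations and cov V = f T + w V turn the geometry into a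
    system of ordinary differential equations for a, n, b and |V|^2.

    If |V| = 1 and n = 0, then a^2 + b^2 = 1, and differentiating the constants
    n and |V|^2 gives kappa a = tau b and w = - f a.  Hence a' = f b^2 and
    b' = - f a b ([rectifying_system]).  Since kappa > 0, a zero of b would be
    a common zero of a and b, so b never vanishes.  Then (1 + a) / b * exp (- F)
    has derivative zero; on the interval it is a constant, whose sign is the
    sign in the statement and whose absolute value is exp r.  Solving
    (1 + a) / b = +- exp (F + r) on the unit circle gives a = tanh (F + r) and
    b = +- sech (F + r) ([tanh_sech_solution]).

    Conversely, tanh^2 + sech^2 = 1 makes the displayed field a unit field
    orthogonal to N ([tanh_sech_dot]), so the same system applies, and
    kappa a = tau b says that tau / kappa = a / b = +- sinh (F + r).  If this
    ratio were constant, differentiating sinh (F + r) would give f = 0, then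
    w = - f a = 0, and V would be parallel. *)

Set Implicit Arguments.
Unset Strict Implicit.

(** * Derivatives relative to an interval *)

Section relative_derivative.
Context {R : realType}.
Implicit Types (I : set R) (s t : R).

Lemma dnbhs_within_sub I s : within I s^' `=>` within I (nbhs s).
Proof. by move=> U; exact: nbhs_dnbhs. Qed.

Lemma deriv_has_deriv (W : normedModType R) I (f : R -> W) s (l : W) :
  has_deriv I f s l -> has_deriv I f s (Defs.deriv I f s).
Proof. by move=> fl; apply: (cvgP l). Qed.

Lemma has_deriv_cvg (W : normedModType R) I (f : R -> W) s (l : W) :
  has_deriv I f s l -> f @ within I (nbhs s) --> f s.
Proof.
move=> fl.
have ft : f @ within I s^' --> f s.
  (* Away from s, f is the point f s plus (t - s) times the bounded difference
     quotient. *)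
  pose h t := f s + (t - s) *: ((t - s)^-1 *: (f t - f s)).
  have hf : h @ within I s^' --> f s.
    rewrite -[X in _ --> X]addr0 -(scale0r l) -(subrr s).
    apply: cvgD; first exact: cvg_cst.
    apply: cvgZ => //; apply: cvgB; last exact: cvg_cst.
    by move=> U /nbhs_dnbhs; rewrite /within/=; apply: filterS.
  apply: cvg_trans hf; apply: near_eq_cvg.
  rewrite near_withinE; apply: filterS (nbhs_dnbhs_neq s) => t ts _.
  by rewrite /h scalerA mulfV ?subr_eq0// scale1r addrC subrK.
move=> U Us; have := ft _ Us; rewrite /within/= /nbhs/= !/within/=.
move=> H; near=> t => It.
have [->|ts] := eqVneq t s; first exact: nbhs_singleton.
by move: ts It; near: t; exact: H.
Unshelve. all: by end_near. Qed.

(** The values of a field outside the times of a chart are junk, and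
    coordinate identities hold only near a given time: derivatives are
    transported along such local identities. *)
Lemma has_deriv_near_eq (W : normedModType R) I (f g : R -> W) s (l : W) :
  (\forall t \near within I (nbhs s), f t = g t) -> f s = g s ->
  has_deriv I f s l -> has_deriv I g s l.
Proof.
move=> fg fgs; apply: cvg_trans; apply: near_eq_cvg.
rewrite near_withinE; apply: nbhs_dnbhs; move: fg; rewrite near_withinE.
by apply: filterS => t fgt It; rewrite fgt// fgs.
Qed.

Lemma has_deriv_cst (W : normedModType R) I s (c : W) :
  has_deriv I (fun=> c) s 0.
Proof.
rewrite /has_deriv [X in X @ _ --> _](_ : _ = fun=> 0); first exact: cvg_cst.
by apply/funext => t; rewrite subrr scaler0.
Qed.

Lemma has_derivD (W : normedModType R) I (f g : R -> W) s (l m : W) :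
  has_deriv I f s l -> has_deriv I g s m ->
  has_deriv I (fun t => f t + g t) s (l + m).
Proof.
move=> fl gm; rewrite /has_deriv.
rewrite [X in X @ _ --> _](_ : _ = fun t => (t - s)^-1 *: (f t - f s) +
  (t - s)^-1 *: (g t - g s)); first exact: cvgD.
by apply/funext => t; rewrite -scalerDr opprD addrACA.
Qed.

Lemma has_derivM I (f g : R -> R) s (l m : R) :
  has_deriv I f s l -> has_deriv I g s m ->
  has_deriv I (fun t => f t * g t) s (l * g s + f s * m).
Proof.
move=> fl gm; rewrite /has_deriv.
rewrite [X in X @ _ --> _](_ : _ = fun t => (t - s)^-1 *: (f t - f s) * g t +
  f s * ((t - s)^-1 *: (g t - g s))); last first.
  by apply/funext => t; rewrite /GRing.scale/=; ring.
apply: cvgD; apply: cvgM; [exact: fl| |exact: cvg_cst|exact: gm].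
apply: cvg_trans (has_deriv_cvg gm).
by apply: cvg_app; exact: dnbhs_within_sub.
Qed.

Lemma has_deriv_sum (W : normedModType R) I n (f : 'I_n -> R -> W) s
    (l : 'I_n -> W) : (forall i, has_deriv I (f i) s (l i)) ->
  has_deriv I (fun t => \sum_i f i t) s (\sum_i l i).
Proof.
elim: n f l => [|n IHn] f l fl.
  rewrite big_ord0 [X in has_deriv _ X](_ : _ = fun=> 0).
    exact: has_deriv_cst.
  by apply/funext => t; rewrite big_ord0.
rewrite big_ord_recr [X in has_deriv _ X](_ : _ = fun t =>
  \sum_(i < n) f (widen_ord (leqnSn n) i) t + f ord_max t).
  by apply: has_derivD => //; exact: IHn.
by apply/funext => t; rewrite big_ord_recr.
Qed.

Lemma has_deriv_coord I m n (f : R -> 'M[R]_(m, n)) s (l : 'M[R]_(m, n)) i j :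
  has_deriv I f s l -> has_deriv I (fun t => f t i j) s (l i j).
Proof.
move=> fl; rewrite /has_deriv.
rewrite [X in X @ _ --> _](_ : _ = (fun A : 'M[R]_(m, n) => A i j) \o
  (fun t => (t - s)^-1 *: (f t - f s))); last first.
  by apply/funext => t; rewrite /= !mxE.
exact: continuous_cvg (@coord_continuous _ _ _ i j l) fl.
Qed.

(** The chain rule for a one-sided inner function: the difference quotient of
    the composite is the differential applied to that of f, plus a remainder
    o(f t - f s) / (t - s), which vanishes because the quotient of f stays
    bounded. *)
Lemma has_deriv_comp (W W' : normedModType R) I (phi : W -> W') (f : R -> W) s
    (l : W) : differentiable phi (f s) -> has_deriv I f s l ->
  has_deriv I (fun t => phi (f t)) s ('d phi (f s) l).
Proof.
move=> dphi fl; rewrite /has_deriv.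
have := diff_locallyxC dphi; set k := 'o_ _ _ => /= phiE.
have q t : (t - s)^-1 *: (phi (f t) - phi (f s)) =
    'd phi (f s) ((t - s)^-1 *: (f t - f s)) +
    (t - s)^-1 *: k (f t - f s).
  have := phiE (f t - f s); rewrite [f s + _]addrC subrK => ->.
  rewrite -[phi (f s) + _ + _]addrA [_ + _ - _]addrAC subrr add0r scalerDr.
  by congr (_ + _); rewrite linearZ.
under eq_fun do rewrite q.
rewrite -['d phi (f s) l]addr0; apply: cvgD.
  by apply: continuous_cvg fl; exact: diff_continuous.
apply/cvgr0Pnorm_lt => e e0.
have lp : 0 < `|l| + 1 by rewrite ltr_wpDl.
have fc : (fun t => f t - f s) @ within I s^' --> (0 : W).
  rewrite -(subrr (f s)); apply: cvgB; last exact: cvg_cst.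
  apply: cvg_trans (has_deriv_cvg fl).
  by apply: cvg_app; exact: dnbhs_within_sub.
have ke : \forall h \near (0 : W), `|k h| <= e / (`|l| + 1) * `|h|.
  by apply: (littleoP [littleo of k]); rewrite divr_gt0.
have kf : \forall t \near within I s^',
  `|k (f t - f s)| <= e / (`|l| + 1) * `|f t - f s| := fc _ ke.
have fb : \forall t \near within I s^',
    `|(t - s)^-1 *: (f t - f s)| < `|l| + 1.
  by apply: cvgr_norm_lt fl _ _; rewrite ltrDl.
near=> t; rewrite normrZ.
apply: le_lt_trans
  (_ : e / (`|l| + 1) * (`|(t - s)^-1 *: (f t - f s)|) < e).
  rewrite [X in _ <= _ * X]normrZ mulrCA ler_wpM2l//; near: t; exact: kf.
by rewrite -mulrA gtr_pMr// mulrC ltr_pdivrMr// mul1r; near: t; exact: fb.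
Unshelve. all: by end_near. Qed.

Lemma has_deriv_comp1 I (phi : R -> R) (f : R -> R) s (l d : R) :
  is_derive (f s) 1 phi d -> has_deriv I f s l ->
  has_deriv I (fun t => phi (f t)) s (d * l).
Proof.
move=> [/derivable1_diffP dphi <-] /(has_deriv_comp dphi).
by rewrite deriveE// mulrC -['d _ _ l]/('d _ _ l) -[in X in X -> _](mulr1 l)
  -[l * 1]/(l *: 1) linearZ.
Qed.

End relative_derivative.

Section interval.
Context {R : realType} (I : set R).
Hypothesis itvI : interval_set I.

(** Near each of its points a nondegenerate interval has other points, so
    relative limits are unique. *)
Lemma interval_within_proper s : I s -> ProperFilter (within I s^').
Proof.
move=> Is; case: itvI => itv [a [b [Ia Ib ab]]].
apply: Build_ProperFilter_ex => P.
rewrite /within/= /dnbhs/= /within/= => /nbhs_ballP[e /= e0 eP].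
have [c [Ic cs]] : exists c, I c /\ c != s.
  by have [<-|] := eqVneq a s; [exists b; rewrite gt_eqF|exists a].
(* Move from s towards c in the same interval, by a fraction d <= 1 small
   enough to stay in the ball of radius e. *)
pose d := Num.min (1 : R) (e / 2 / `|c - s|).
have d0 : 0 < d.
  by rewrite lt_min ltr01/= !divr_gt0// normr_gt0 subr_eq0.
have d1 : d <= 1 by rewrite ge_min lexx.
pose t := s + d * (c - s).
exists t; apply: eP.
- rewrite -ball_normE/= /t opprD addNKr normrN normrM gtr0_norm//.
  have : d <= e / 2 / `|c - s| by rewrite ge_min lexx orbT.
  rewrite ler_pdivlMr ?normr_gt0 ?subr_eq0// => /le_lt_trans; apply.
  by rewrite ltr_pdivrMr// ltr_pMr// ltr1n.
- rewrite /t -subr_eq0 addrAC subrr add0r; apply: mulf_neq0.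
    by rewrite gt_eqF.
  by rewrite subr_eq0.
- have [sc|sc|sc] := ltgtP s c; last by rewrite sc eqxx in cs.
    by apply: (itv s c) => //; rewrite /t; apply/andP; split; nra.
  by apply: (itv c s) => //; rewrite /t; apply/andP; split; nra.
Qed.

Lemma has_deriv_unique (W : normedModType R) (f : R -> W) s (l m : W) : I s ->
  has_deriv I f s l -> has_deriv I f s m -> l = m.
Proof.
move=> Is fl fm; have pf := interval_within_proper Is.
exact: (@norm_cvg_unique _ _ _ _ _ _ fl fm).
Qed.

Lemma interior_near a b s : I a -> I b -> a < s < b -> \forall t \near s, I t.
Proof.
move=> Ia Ib sab; have : \forall t \near s, t \in `]a, b[.
  exact: near_in_itvoo.
apply: filterS => t; rewrite in_itv/= => /andP[at_ tb].
by apply: (itvI.1 a b) => //; rewrite !ltW.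
Qed.

(** At interior points the relative derivative is the ordinary one, and at the
    ends it still gives continuity, which is what the mean value theorem
    requires. *)
Lemma has_deriv0_cst (f : R -> R) :
  (forall s, I s -> has_deriv I f s 0) ->
  forall s t, I s -> I t -> f s = f t.
Proof.
move=> f0 s t Is It.
wlog st : s t Is It / s <= t.
  by move=> H; have [/H|/ltW/H] := leP s t; [apply|move=> ->].
have Ist x : s <= x <= t -> I x by exact: (itvI.1 s t Is It).
have [||c _] := @MVT_segment R f (fun=> 0) s t st.
- move=> x; rewrite in_itv/= => sxt.
  have Ix : I x by apply: Ist; case/andP: sxt => ? ?; rewrite !ltW.
  have D : (h^-1 *: ((f \o shift x) (h *: 1) - f x)) @[h --> 0^'] --> (0 : R).
    apply/cvgr0Pnorm_lt => e e0.
    have : \forall y \near within I x^', `|(y - x)^-1 *: (f y - f x)| < e.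
      move: e0; apply: cvgr0_norm_lt; exact: f0.
    rewrite near_withinE => fx.
    have {}fx : \forall y \near x^', `|(y - x)^-1 *: (f y - f x)| < e.
      apply: filterS2 fx (nbhs_dnbhs (interior_near Is It sxt)) => y.
      exact.
    have {}fx : \forall y \near x, y != x ->
      `|(y - x)^-1 *: (f y - f x)| < e := fx.
    move: fx; rewrite (near_shift 0 x) subr0 => fx.
    rewrite /dnbhs near_withinE; apply: filterS fx => h hx h0.
    by move: hx; rewrite /= addrK [h%:A]mulr1; apply; rewrite -subr_eq0 addrK.
  by apply: DeriveDef; [exact: (cvgP _ D)|exact: cvg_lim D].
- apply/subspace_continuousP => x; rewrite /= in_itv/= => sxt.
  apply: cvg_trans (has_deriv_cvg (f0 x (Ist _ sxt))).
  apply: cvg_app => U; rewrite /nbhs/= /within/=; apply: filterS => y UI.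
  rewrite in_itv/= => yst; exact: UI (Ist y yst).
- by rewrite mul0r => /subr0_eq.
Qed.

End interval.

(** Outside the closure of the interval the iterated derivatives are arbitrary
    values of the limit operator, so only their values on the interval can be
    controlled. *)
Lemma smooth_on_cst (R : realType) (I : set R) (c : R) : interval_set I ->
  smooth_on I I (fun=> c : R).
Proof.
move=> itvI k.
have [d kd] : exists d : R,
    forall s, I s -> iter k (Defs.deriv I) (fun=> c) s = d.
  elim: k => [|k [d kd]]; first by exists c.
  exists 0 => s Is; rewrite iterS.
  have k0 : has_deriv I (iter k (Defs.deriv I) (fun=> c)) s 0.
    apply: has_deriv_near_eq (has_deriv_cst I s d); last by rewrite kd.
    by rewrite near_withinE; apply: nearW => t It; rewrite kd.
  exact: (has_deriv_unique itvI Is (deriv_has_deriv k0) k0).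
move=> s Is; exists 0.
apply: has_deriv_near_eq (has_deriv_cst I s d); last by rewrite kd.
by rewrite near_withinE; apply: nearW => t It; rewrite kd.
Qed.

(** * Matrices and partial derivatives *)

Section matrix_derivative.
Context {R : realType}.
Implicit Types (I : set R) (s : R).

(** Entrywise, so that the product rule reduces to the scalar one. *)
Definition has_deriv_mx I m n (X : R -> 'M[R]_(m, n)) s (X' : 'M[R]_(m, n)) :=
  forall i j, has_deriv I (fun t => X t i j) s (X' i j).

Lemma has_deriv_mulmx I m n p (X : R -> 'M[R]_(m, n)) (Y : R -> 'M[R]_(n, p)) s
    X' Y' : has_deriv_mx I X s X' -> has_deriv_mx I Y s Y' ->
  has_deriv_mx I (fun t => X t *m Y t) s (X' *m Y s + X s *m Y').
Proof.
move=> dX dY i j; rewrite !mxE -big_split/=.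
rewrite [X in has_deriv _ X](_ : _ = fun t => \sum_k X t i k * Y t k j).
  by apply: has_deriv_sum => k; exact: has_derivM.
by apply/funext => t; rewrite mxE.
Qed.

Lemma has_deriv_trmx I m n (X : R -> 'M[R]_(m, n)) s X' :
  has_deriv_mx I X s X' -> has_deriv_mx I (fun t => (X t)^T) s X'^T.
Proof.
move=> dX i j; rewrite mxE [X in has_deriv _ X](_ : _ = fun t => X t j i)//.
by apply/funext => t; rewrite mxE.
Qed.

End matrix_derivative.

Lemma bilinear_form_sym (R : comPzRingType) n (G : 'M[R]_n) (x y : 'rV[R]_n) :
  G^T = G -> (x *m G *m y^T) 0 0 = (y *m G *m x^T) 0 0.
Proof.
move=> GT; transitivity ((x *m G *m y^T)^T 0 0); first by rewrite [RHS]mxE.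
by rewrite !trmx_mul trmxK GT mulmxA.
Qed.

(** If P has the rows u1, u2, u3, orthonormality says P G P^T = 1, that is,
    G P^T is a right inverse of the square matrix P.  It is then a left inverse
    too, and v = (v G P^T) P is the expansion. *)
Lemma orthonormal_expansion (R : comPzRingType) (G : 'M[R]_3)
    (u1 u2 u3 v : 'rV[R]_3) :
  let ip (x y : 'rV[R]_3) := (x *m G *m y^T) 0 0 in
  G^T = G ->
  [/\ ip u1 u1 = 1, ip u2 u2 = 1 & ip u3 u3 = 1] ->
  [/\ ip u1 u2 = 0, ip u1 u3 = 0 & ip u2 u3 = 0] ->
  v = ip v u1 *: u1 + ip v u2 *: u2 + ip v u3 *: u3.
Proof.
move=> ip GT [u11 u22 u33] [u12 u13 u23].
have ipC x y : ip x y = ip y x by exact: bilinear_form_sym.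
pose u := nth 0 [:: u1; u2; u3].
pose P : 'M[R]_3 := \matrix_(a < 3) u a.
have vP (x : 'rV[R]_3) (b : 'I_3) : (x *m G *m P^T) 0 b = ip x (u b).
  by rewrite /ip !mxE; apply: eq_bigr => k _; rewrite !mxE.
have PG (a b : 'I_3) : (P *m G *m P^T) a b = ip (u a) (u b).
  have uaE : u a = row a P by rewrite rowK.
  by rewrite -vP uaE -!row_mul [RHS]mxE.
have PP : P *m (G *m P^T) = 1%:M.
  apply/matrixP => a b; rewrite mulmxA PG mxE.
  case: a => -[|[|[|//]]] ia; case: b => -[|[|[|//]]] ib //=;
   by rewrite /u/= // ipC.
have vE : v = v *m G *m P^T *m P.
  by rewrite -!mulmxA (mulmxA G) (mulmx1C PP) mulmx1.
rewrite [LHS]vE mulmx_sum_row !big_ord_recl big_ord0 addr0 addrA.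
by rewrite !vP !rowK.
Qed.

Section differential.
Context {R : realType}.

Lemma diff_partial (W : normedModType R) (phi : 'rV[R]_3 -> W) x v :
  differentiable phi x -> 'd phi x v = \sum_(c < 3) v 0 c *: partial c phi x.
Proof.
move=> dphi; rewrite [in LHS](row_sum_delta v) linear_sum.
by apply: eq_bigr => c _; rewrite linearZ /partial deriveE.
Qed.

Lemma smooth_map_differentiable (W : normedModType R) U (phi : 'rV[R]_3 -> W)
    x :
  smooth_map U phi -> U x -> differentiable phi x.
Proof. by move=> /(_ 1)[+ _]; exact. Qed.

End differential.

(** * Vector fields along a curve, in charts *)

Section curve.
Context {R : realType} {M : topologicalType} {A : manifold3 R M}.
Variables (g : riemannian_metric A) (D : affine_connection A).
Variables (I : set R) (gam : R -> M).
Hypotheses (itvI : interval_set I) (sm : smooth_curve (A := A) I gam).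
Implicit Types V W : along (A := A).
Local Notation chart_times := (chart_times (A := A) I gam).
Local Notation vel := (velocity (A := A) I gam).
Local Notation cov := (cov D I gam).
Local Notation dot := (dot g gam).

(** By continuity, the times of a chart are relatively open in the interval. *)
Lemma chart_times_near i s : chart_times i s ->
  \forall t \near within I (nbhs s), chart_times i t.
Proof.
move=> [Is is_]; have /subspace_continuousP/(_ s Is) := sm.1.
move=> /(_ (dom i)) H.
have : \forall t \near within I (nbhs s), dom i (gam t).
  by apply: H; apply: open_nbhs_nbhs; split => //; exact: dom_open.
by rewrite !near_withinE; apply: filterS => t h It; split=> //; exact: h.
Qed.

Definition derivable_along V :=
  forall i s, chart_times i s -> exists l, has_deriv I (V i) s l.

(** The transformation law that makes V a field of tangent vectors; it is
    separated from smoothness so that it can be stated for the velocity. *)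
Definition tensorial V := forall i j s, chart_times i s -> chart_times j s ->
  V j s = V i s *m tjac i j (gam s).

Lemma vector_field_derivable V : vector_field_along I gam V ->
  derivable_along V.
Proof. by move=> [h _] i s; exact: (h i 0). Qed.

Lemma velocity_derivable : derivable_along vel.
Proof. by move=> i s; exact: (sm.2 i 1). Qed.

Lemma velocityP i s : chart_times i s ->
  has_deriv I (chart_map i \o gam) s (vel i s).
Proof. by move=> /(sm.2 i 0)[l]; exact: deriv_has_deriv. Qed.

(** In the chart j the curve is, near s, the curve in the chart i followed by
    the transition map, so this is the chain rule. *)
Lemma velocity_tensorial : tensorial vel.
Proof.
move=> i j s si sj.
have di : differentiable (transition i j) (chart_map i (gam s)).
  apply: smooth_map_differentiable (transition_smooth i j) _.
  by exists (gam s) => //; split; [exact: si.2|exact: sj.2].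
apply: (has_deriv_unique itvI si.1 (velocityP sj)).
rewrite /tjac /jacobian mul_rV_lin1.
apply: has_deriv_near_eq (has_deriv_comp di (velocityP si)).
  near=> t; rewrite /transition/= chart_mapK//.
  suff [] : chart_times i t by [].
  by near: t; exact: chart_times_near.
by rewrite /transition/= chart_mapK//; exact: si.2.
Unshelve. all: by end_near. Qed.

Lemma dot_chart_independent V W i j s : tensorial V -> tensorial W ->
  chart_times i s -> chart_times j s -> dot i s V W = dot j s V W.
Proof.
move=> tV tW si sj.
rewrite /dot (tV i j)// (tW i j)// (gram_compat g si.2 sj.2).
by rewrite trmx_mul !mulmxA.
Qed.

Lemma dot_sym V W i s : chart_times i s -> dot i s V W = dot i s W V.
Proof.
move=> si; apply: bilinear_form_sym; apply: gram_sym.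
by exists (gam s) => //; exact: si.2.
Qed.

Lemma dot_lin_l (x y : R) U V W Z i s : U i s = x *: V i s + y *: W i s ->
  dot i s U Z = x * dot i s V Z + y * dot i s W Z.
Proof.
by move=> UE; rewrite /dot UE !mulmxDl -!scalemxAl !mxE.
Qed.

Lemma dot_scale_l (x : R) U V Z i s : U i s = x *: V i s ->
  dot i s U Z = x * dot i s V Z.
Proof. by move=> UE; rewrite /dot UE -!scalemxAl !mxE. Qed.

(** With C the matrix of the connection form on the velocity, cov V = V' + V C,
    and metric compatibility reads G' = C G + G C^T along the curve.  The
    derivative of V G W^T then regroups into the two covariant terms. *)
Lemma dot_deriv V W i s : metric_connection g D ->
  derivable_along V -> derivable_along W -> chart_times i s ->
  has_deriv I (fun t => dot i t V W) s
    (dot i s (cov V) W + dot i s V (cov W)).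
Proof.
move=> mc dV dW si.
have [lV /deriv_has_deriv hV] := dV i s si.
have [lW /deriv_has_deriv hW] := dW i s si.
have xs : (chart_map i @` dom i) (chart_map i (gam s)).
  by exists (gam s) => //; exact: si.2.
pose G := gram g i (chart_map i (gam s)).
pose C : 'M[R]_3 := \matrix_(a, d) \sum_(c < 3)
  vel i s 0 c * christoffel D i (chart_map i (gam s)) c a 0 d.
have covE U : cov U i s = Defs.deriv I (U i) s + U i s *m C.
  rewrite /cov; congr (_ + _); rewrite exchange_big/=; apply/rowP => d.
  rewrite summxE mxE; apply: eq_bigr => a _.
  rewrite summxE mxE mulr_sumr; apply: eq_bigr => c _.
  by rewrite mxE mulrCA mulrA.
have dG : has_deriv_mx I (fun t => gram g i (chart_map i (gam t))) s
    (C *m G + G *m C^T).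
  move=> a b; pose phi x := gram g i x a b.
  have dphi : differentiable phi (chart_map i (gam s)).
    apply: (@differentiable_comp _ _ _ _ (gram g i)
      (fun N : 'M[R]_3 => N a b)).
      exact: smooth_map_differentiable (gram_smooth g i) xs.
    exact: differentiable_coord.
  have := has_deriv_comp dphi (velocityP si); rewrite diff_partial//.
  congr (has_deriv _ _ _ _).
  under eq_bigr do rewrite (mc i _ a b _ xs) scaler_sumr.
  rewrite exchange_big/= !mxE -big_split/=; apply: eq_bigr => d _.
  rewrite !mxE mulr_suml mulr_sumr -big_split/=; apply: eq_bigr => c _.
  by rewrite /G /GRing.scale/=; ring.
have mV : has_deriv_mx I (V i) s (Defs.deriv I (V i) s).
  by move=> a b; exact: has_deriv_coord hV.
have mW : has_deriv_mx I (W i) s (Defs.deriv I (W i) s).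
  by move=> a b; exact: has_deriv_coord hW.
have := has_deriv_mulmx (has_deriv_mulmx mV dG) (has_deriv_trmx mW).
move=> /(_ 0 0); congr (has_deriv _ _ _ _).
rewrite /dot !covE -/G [(_ + _)^T]linearD/= trmx_mul !mulmxDl !mulmxDr !mulmxA.
have entryD (x y : 'M[R]_1) : (x + y) 0 0 = x 0 0 + y 0 0 by rewrite mxE.
by rewrite mulmxDl !entryD; ring.
Qed.

End curve.

(** * Hyperbolic functions and the differential system *)

Section hyperbolic_functions.
Context {R : realType}.
Implicit Types (x : R).

Lemma cosh_gt0 x : 0 < cosh x.
Proof. by rewrite divr_gt0// addr_gt0// expR_gt0. Qed.

Lemma cosh2_sub_sinh2 x : cosh x ^+ 2 - sinh x ^+ 2 = 1.
Proof.
by rewrite /cosh /sinh expRN; field; rewrite gt_eqF// expR_gt0.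
Qed.

Lemma tanh2_add_sech2 x : tanh x ^+ 2 + sech x ^+ 2 = 1.
Proof.
have c0 : cosh x != 0 by rewrite gt_eqF// cosh_gt0.
transitivity ((sinh x ^+ 2 + (cosh x ^+ 2 - sinh x ^+ 2)) / cosh x ^+ 2).
  by rewrite cosh2_sub_sinh2 /tanh /sech; field.
by rewrite addrC subrK mulfV// expf_neq0.
Qed.

Lemma is_derive_expRN x : is_derive x 1 (fun y => expR (- y)) (- expR (- x)).
Proof. by apply: is_derive_eq; rewrite /GRing.scale/=; ring. Qed.

Lemma is_derive_sinh x : is_derive x 1 sinh (cosh x).
Proof.
have := is_derive_expRN x => ?.
rewrite (_ : sinh = (fun y : R => 2^-1 *: (expR y - expR (- y)))); last first.
  by apply/funext => y; rewrite /sinh mulrC.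
by apply: is_derive_eq; rewrite /cosh /GRing.scale/=; ring.
Qed.

(** The circle a^2 + b^2 = 1 without its two points b = 0 is parametrized by
    (1 + a) / b, which satisfies the linear equation u' = f u; hence
    u * exp (- F) is constant. *)
Lemma tanh_sech_solution (I : set R) (a b f F : R -> R) : interval_set I ->
  (forall s, I s -> a s ^+ 2 + b s ^+ 2 = 1) ->
  (forall s, I s -> b s != 0) ->
  (forall s, I s -> has_deriv I a s (f s * b s ^+ 2)) ->
  (forall s, I s -> has_deriv I b s (- (f s * a s * b s))) ->
  antiderivative I f F ->
  exists (sg : bool) (r : R), forall s, I s ->
    a s = tanh (F s + r) /\ b s = (-1) ^+ sg * sech (F s + r).
Proof.
move=> itvI ab b0 da db dF.
have b2 s : I s -> b s ^+ 2 = (1 - a s) * (1 + a s).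
  by move=> Is; rewrite -subr_sqr expr1n -(ab s Is); ring.
have a1 s : I s -> 1 + a s != 0.
  move=> Is; apply: contra (b0 s Is) => /eqP a1.
  by rewrite -sqrf_eq0 b2// a1 mulr0.
pose h t := (1 + a t) * (b t)^-1 * expR (- F t).
have dh s : I s -> has_deriv I h s 0.
  move=> Is; have bs0 := b0 s Is.
  have dV : is_derive (b s) 1 (fun x : R => x^-1) (- b s ^- 2).
    by apply: is_derive_eq (is_deriveV bs0 _) _; rewrite /GRing.scale/= mulr1.
  have da1 := has_derivD (has_deriv_cst I s (1 : R)) (da s Is).
  have dbV := has_deriv_comp1 dV (db s Is).
  have := has_derivM (has_derivM da1 dbV)
    (has_deriv_comp1 (is_derive_expRN (F s)) (dF s Is)).
  rewrite /h; congr (has_deriv _ _ _ _).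
  transitivity (f s * expR (- F s) / b s *
    (b s ^+ 2 - (1 - a s) * (1 + a s))); first by field.
  by rewrite b2// subrr mulr0.
have [s0 Is0] : exists s0, I s0.
  by case: itvI => _ [x [y [Ix _ _]]]; exists x.
have c0 : h s0 != 0.
  by rewrite !mulf_neq0 ?invr_eq0 ?b0 ?a1// gt_eqF// expR_gt0.
(* The constant value of h is +- exp r. *)
exists (h s0 < 0), (ln `|h s0|) => s Is.
have hs := has_deriv0_cst itvI dh Is Is0.
set E := expR (F s + ln `|h s0|).
have E0 : 0 < E by exact: expR_gt0.
set sg : R := (-1) ^+ (h s0 < 0)%R.
have sg2 : sg * sg = 1 by rewrite /sg -expr2 sqrr_sign.
have bE : 1 + a s = sg * E * b s.
  rewrite /E expRD lnK ?posrE ?normr_gt0// mulrCA -numEsign -hs /h expRN.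
  by field; rewrite b0// gt_eqF// expR_gt0.
have Eb : b s = sg * E * (1 - a s).
  by apply: (mulfI (b0 s Is)); rewrite -expr2 b2// bE; ring.
have aE : a s * (E ^+ 2 + 1) = E ^+ 2 - 1.
  have : 1 + a s = E ^+ 2 * (1 - a s) by rewrite bE Eb -[RHS]mul1r -sg2; ring.
  lra.
have E21 : E ^+ 2 + 1 != 0 by rewrite gt_eqF// ltr_wpDl// sqr_ge0.
have {}aE : a s = (E ^+ 2 - 1) / (E ^+ 2 + 1) by rewrite -aE mulfK.
rewrite /tanh /sech /sinh /cosh expRN -/E.
have En : E != 0 by rewrite gt_eqF.
split; first by rewrite aE; field; rewrite En E21.
by rewrite Eb aE; field; rewrite En E21.
Qed.

End hyperbolic_functions.

(** * Chart-independent scalar products *)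

Section scalar_product_along_curve.
Context {R : realType} {M : topologicalType} {A : manifold3 R M}.
Variables (g : riemannian_metric A) (D : affine_connection A).
Variables (I : set R) (gam : R -> M).
Hypotheses (itvI : interval_set I) (sm : smooth_curve (A := A) I gam).
Implicit Types V W : along (A := A).
Local Notation chart_times := (chart_times (A := A) I gam).
Local Notation vel := (velocity (A := A) I gam).
Local Notation cov := (cov D I gam).
Local Notation dot := (dot g gam).

(** Components live in charts, whereas the differential system needs functions
    on the whole interval: at each time some chart around the point is chosen,
    and [dot_inner] shows that the choice does not matter. *)
Definition chart_at s : chart A := projT1 (cid (dom_cover A (gam s))).

Definition inner V W s := dot (chart_at s) s V W.

Lemma chart_at_times s : I s -> chart_times (chart_at s) s.
Proof. by move=> Is; split=> //; rewrite /chart_at; case: cid. Qed.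

Lemma dot_inner V W i s : tensorial I gam V -> tensorial I gam W ->
  chart_times i s -> dot i s V W = inner V W s.
Proof.
move=> tV tW si.
exact: dot_chart_independent tV tW si (chart_at_times si.1).
Qed.

Lemma inner_deriv V W s : metric_connection g D ->
  tensorial I gam V -> tensorial I gam W ->
  derivable_along I gam V -> derivable_along I gam W -> I s ->
  has_deriv I (inner V W) s (inner (cov V) W s + inner V (cov W) s).
Proof.
move=> mc tV tW dV dW Is; have si := chart_at_times Is.
apply: has_deriv_near_eq (dot_deriv sm mc dV dW si); last by [].
near=> t; apply: dot_inner => //.
by near: t; exact: chart_times_near.
Unshelve. all: by end_near. Qed.

End scalar_product_along_curve.

(** * Unit torse-forming fields orthogonal to the principal normal *)

Section torse_forming_along_frenet_curve.
Context {R : realType} {M : topologicalType} {A : manifold3 R M}.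
Variables (g : riemannian_metric A) (o : orientation A)
  (D : affine_connection A).
Variables (I : set R) (gam : R -> M).
Variables (N B V : along (A := A)) (kappa tau f w : R -> R).
Local Notation chart_times := (chart_times (A := A) I gam).
Local Notation T := (velocity (A := A) I gam).
Local Notation cov := (cov D I gam).
Local Notation dot := (dot g gam).
Local Notation inner := (inner g gam).
Hypotheses (mc : metric_connection g D) (itvI : interval_set I)
  (sm : smooth_curve (A := A) I gam)
  (frenet : frenet_frame g o D I gam N B kappa tau)
  (vfV : vector_field_along I gam V)
  (torse : forall i s, chart_times i s ->
     cov V i s = f s *: T i s + w s *: V i s).

Lemma frame_expansion i s : chart_times i s ->
  V i s = dot i s V T *: T i s + dot i s V N *: N i s + dot i s V B *: B i s.
Proof.
move=> si; case: frenet => _ [/(_ i s si)[n1 n0] _] _ _ _.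
apply: (orthonormal_expansion (G := gram g i (chart_map i (gam s)))) => //.
by apply: gram_sym; exists (gam s) => //; exact: si.2.
Qed.

Hypotheses (unitV : forall i s, chart_times i s -> dot i s V V = 1)
  (normalV : forall i s, chart_times i s -> dot i s V N = 0).

Lemma rectifying_expansion i s : chart_times i s ->
  V i s = inner V T s *: T i s + inner V B s *: B i s.
Proof.
move=> si; have [[_ tN] [_ tB]] := let: And5 vf _ _ _ _ := frenet in vf.
have tT := velocity_tensorial itvI sm.
have dotE W : tensorial I gam W -> dot i s V W = inner V W s.
  by move=> tW; exact: dot_inner vfV.2 tW si.
by rewrite [LHS]frame_expansion// normalV// scale0r addr0 !dotE.
Qed.

(** The last two equations come from the derivatives of <V,T> and <V,B>; the
    two in the middle from those of the constants <V,N> = 0 and <V,V> = 1. *)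
Lemma rectifying_system s : I s ->
  [/\ inner V T s ^+ 2 + inner V B s ^+ 2 = 1,
      kappa s * inner V T s = tau s * inner V B s &
      w s = - (f s * inner V T s)] /\
  has_deriv I (inner V T) s (f s * inner V B s ^+ 2) /\
  has_deriv I (inner V B) s (- (f s * inner V T s * inner V B s)).
Proof.
move=> Is; have si := chart_at_times (A := A) gam Is.
case: frenet => -[vfN vfB] [ortho _] _ _ /(_ _ _ si)[cT cN cB].
have [[n1 n2 n3] [n4 n5 n6]] := ortho _ _ si.
have tT := velocity_tensorial itvI sm.
have dT := velocity_derivable sm.
have dV := vector_field_derivable vfV; have dB := vector_field_derivable vfB.
have dN := vector_field_derivable vfN.
set a := inner V T; set b := inner V B.
have nV t : I t -> inner V N t = 0.
  by move=> It; apply: normalV; exact: chart_at_times.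
have uV t : I t -> inner V V t = 1.
  by move=> It; apply: unitV; exact: chart_at_times.
have covV W : inner (cov V) W s = f s * inner T W s + w s * inner V W s.
  exact: dot_lin_l (torse si).
have covT W : inner (cov T) W s = kappa s * inner N W s.
  exact: dot_scale_l cT.
have covN W : inner (cov N) W s = - kappa s * inner T W s + tau s * inner B W s.
  exact: dot_lin_l cN.
have covB W : inner (cov B) W s = - tau s * inner N W s.
  exact: dot_scale_l cB.
have symm U W : inner U W s = inner W U s by exact: dot_sym si.
have TT : inner T T s = 1 := n1.
have TN : inner T N s = 0 := n4.
have TB : inner T B s = 0 := n5.
have NV : inner N V s = 0 by rewrite symm nV.
have VT : has_deriv I a s (f s + w s * a s).
  have := inner_deriv sm mc vfV.2 tT dV dT Is.
  rewrite covV [inner V (cov T) s]symm covT NV TT mulr0 mulr1 addr0.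
  exact.
have VB : has_deriv I b s (w s * b s).
  have := inner_deriv sm mc vfV.2 vfB.2 dV dB Is.
  rewrite covV [inner V (cov B) s]symm covB NV TB !mulr0 add0r addr0.
  exact.
have VN : kappa s * a s = tau s * b s.
  have dVN : has_deriv I (inner V N) s 0.
    apply: has_deriv_near_eq (has_deriv_cst I s (0 : R)); last by rewrite nV.
    by rewrite near_withinE; apply: nearW => t It; rewrite nV.
  have := has_deriv_unique itvI Is dVN (inner_deriv sm mc vfV.2 vfN.2 dV dN Is).
  rewrite covV [inner V (cov N) s]symm covN TN nV// [inner T V s]symm.
  by rewrite [inner B V s]symm -/(a s) -/(b s); lra.
have VV : f s * a s + w s = 0.
  have dVV : has_deriv I (inner V V) s 0.
    apply: has_deriv_near_eq (has_deriv_cst I s (1 : R)); last by rewrite uV.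
    by rewrite near_withinE; apply: nearW => t It; rewrite uV.
  have := has_deriv_unique itvI Is dVV (inner_deriv sm mc vfV.2 vfV.2 dV dV Is).
  rewrite [inner V (cov V) s]symm covV uV// [inner T V s]symm -/(a s); lra.
have ab : a s ^+ 2 + b s ^+ 2 = 1.
  have <- : inner V V s = 1 by exact: uV.
  have -> : inner V V s = a s * inner T V s + b s * inner B V s.
    exact: dot_lin_l (rectifying_expansion si).
  by rewrite [inner T V s]symm [inner B V s]symm !expr2.
have wE : w s = - (f s * a s) by lra.
split; first by [].
split.
  move: VT; congr (has_deriv _ _ _ _); rewrite wE.
  have -> : b s ^+ 2 = 1 - a s ^+ 2 by rewrite -ab; ring.
  ring.
by move: VB; congr (has_deriv _ _ _ _); rewrite wE; ring.
Qed.

End torse_forming_along_frenet_curve.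

(** * The equivalence and the ratio of the curvatures *)

(** The square root of a negative number is 0, so a norm equal to 1 forces the
    scalar square to be 1. *)
Lemma sqrt_eq1 (R : rcfType) (x : R) : Num.sqrt x = 1 -> x = 1.
Proof.
move=> x1; have x0 : 0 <= x.
  rewrite leNgt; apply/negP => /ltW/ler0_sqrtr.
  by rewrite x1 => /eqP; rewrite oner_eq0.
by rewrite -(sqr_sqrtr x0) x1 expr1n.
Qed.

Section tanh_sech.
Context {R : realType} {M : topologicalType} {A : manifold3 R M}.
Variables (g : riemannian_metric A) (I : set R) (gam : R -> M).
Variables (N B V : along (A := A)).
Local Notation T := (velocity (A := A) I gam).
Hypothesis ortho : orthonormal_frame g I gam T N B.

Lemma tanh_sech_dot sg p i s : tanh_sech_form I gam V B sg p ->
  chart_times I gam i s ->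
  [/\ dot g gam i s V V = 1, dot g gam i s V N = 0,
      dot g gam i s V T = tanh (p s) &
      dot g gam i s V B = (-1) ^+ sg * sech (p s)].
Proof.
move=> /(_ i s) VE si; have [[n1 n2 n3] [n4 n5 n6]] := ortho si.
have VW W := @dot_lin_l _ _ _ g gam _ _ _ _ _ W _ _ (VE si).
have symm U W := @dot_sym _ _ _ g _ _ U W _ _ si.
have VT : dot g gam i s V T = tanh (p s).
  by rewrite VW [dot g gam i s B T]symm n1 n5 mulr1 mulr0 addr0.
have VB : dot g gam i s V B = (-1) ^+ sg * sech (p s).
  by rewrite VW n5 n3 mulr0 add0r mulr1.
split=> //; last by rewrite VW [dot g gam i s B N]symm n4 n6 !mulr0 addr0.
rewrite VW [dot g gam i s T V]symm [dot g gam i s B V]symm VT VB.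
rewrite -[RHS](tanh2_add_sech2 (p s)).
transitivity (tanh (p s) ^+ 2 + ((-1) ^+ sg) ^+ 2 * sech (p s) ^+ 2).
  by ring.
by rewrite sqrr_sign mul1r.
Qed.

End tanh_sech.

Unset Implicit Arguments.
Set Strict Implicit.

Theorem theorem3p3 (R : realType) (M : topologicalType) (A : manifold3 R M)
    (g : riemannian_metric A) (o : orientation A) (D : affine_connection A)
    (I : set R) (gam : R -> M) (N B : along (A := A)) (kappa tau : R -> R)
    (V : along (A := A)) (f F : R -> R) :
  connected [set: M] ->
  levi_civita g D ->
  interval_set I ->
  frenet_curve D I gam ->
  arc_length_param g I gam ->
  frenet_frame g o D I gam N B kappa tau ->
  vector_field_along I gam V ->
  torse_forming D I gam V f ->
  ~ parallel D I gam V ->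
  antiderivative I f F ->
  (PA_curve g I gam N V (fun=> pi / 2) <->
     exists (sg : bool) (r : R),
       tanh_sech_form I gam V B sg (fun s => F s + r)) /\
  (forall (sg : bool) (r : R),
     tanh_sech_form I gam V B sg (fun s => F s + r) ->
     (forall s, I s -> tau s / kappa s = (-1) ^+ sg * sinh (F s + r)) /\
     ~ (exists c : R, forall s, I s -> tau s / kappa s = c)).
Proof.
move=> _ [_ mc] itvI [sm _] _ fr vfV [_ [w [_ torse]]] nonpar dF.
have ortho : orthonormal_frame g I gam (velocity I gam) N B.
  by case: fr => _ [].
have pos : forall s, I s -> 0 < kappa s /\ 0 < tau s by case: fr.
split; [split|].
- move=> [_ _ nV tV].
  have unitV i s : chart_times I gam i s -> dot g gam i s V V = 1.
    by move=> si; apply: sqrt_eq1; exact: nV.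
  have normalV i s : chart_times I gam i s -> dot g gam i s V N = 0.
    by move=> si; rewrite -tV// cos_pihalf.
  have sys := rectifying_system mc itvI sm fr vfV torse unitV normalV.
  have b0 s : I s -> inner g gam V B s != 0.
    move=> Is; have [[ab ktab _] _] := sys s Is; have [k0 _] := pos s Is.
    apply/eqP => b0; move: ab ktab; rewrite b0 mulr0 => ab /eqP.
    rewrite mulf_eq0 gt_eqF//= => /eqP a0; move: ab => /eqP.
    by rewrite a0 expr0n addr0 eq_sym oner_eq0.
  have [|||sg [r sol]] := tanh_sech_solution
    (a := inner g gam V (velocity I gam)) itvI _ b0 _ _ dF.
  + by move=> s /sys[[]].
  + by move=> s /sys[_ []].
  + by move=> s /sys[_ []].
  exists sg, r => i s si.
  rewrite (rectifying_expansion itvI sm fr vfV normalV si).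
  by have [-> ->] := sol s si.1.
- move=> [sg [r VE]].
  have dVE i s si := tanh_sech_dot ortho (i := i) (s := s) VE si.
  split.
  + move=> i s si; apply/eqP => V0; have [+ _ _ _] := dVE i s si.
    by rewrite /dot V0 !mul0mx mxE => /eqP; rewrite eq_sym oner_eq0.
  + split; first exact: smooth_on_cst.
    move=> s _; rewrite divr_ge0 ?pi_ge0//= ler_pdivrMr//.
    by rewrite ler_peMr ?pi_ge0// ler1n.
  + by move=> i s si; have [V1 _ _ _] := dVE i s si; rewrite /norm V1 sqrtr1.
  + by move=> i s si; have [_ -> _ _] := dVE i s si; rewrite cos_pihalf.
- move=> sg r VE.
  have dVE i s si := tanh_sech_dot ortho (i := i) (s := s) VE si.
  have unitV i s : chart_times I gam i s -> dot g gam i s V V = 1.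
    by move=> si; case: (dVE i s si).
  have normalV i s : chart_times I gam i s -> dot g gam i s V N = 0.
    by move=> si; case: (dVE i s si).
  have sys := rectifying_system mc itvI sm fr vfV torse unitV normalV.
  have abE s : I s -> inner g gam V (velocity I gam) s = tanh (F s + r) /\
      inner g gam V B s = (-1) ^+ sg * sech (F s + r).
    by move=> Is; have [] := dVE _ _ (chart_at_times gam Is).
  have ratio s : I s -> tau s / kappa s = (-1) ^+ sg * sinh (F s + r).
    move=> Is; have [[_ + _] _] := sys s Is; have [-> ->] := abE s Is.
    have [k0 _] := pos s Is; have c0 := cosh_gt0 (F s + r).
    have sg2 : (-1) ^+ sg * (-1) ^+ sg = 1 :> R by rewrite -expr2 sqrr_sign.
    set sgn : R := (-1) ^+ sg in sg2 *; rewrite /tanh /sech => ktE.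
    have -> : tau s = sgn * sgn * tau s by rewrite sg2 mul1r.
    transitivity (sgn * cosh (F s + r) / kappa s *
      (tau s * (sgn * (cosh (F s + r))^-1))); first by field; rewrite !gt_eqF.
    by rewrite -ktE; field; rewrite !gt_eqF.
  split=> // -[c cst]; apply: nonpar => i s si.
  (* A constant ratio makes sinh (F + r) constant, and its derivative is
     cosh (F + r) * f. *)
  have f0 : f s = 0.
    have dp : has_deriv I (fun t => F t + r) s (f s).
      have := has_derivD (dF s si.1) (has_deriv_cst I s r).
      by rewrite addr0; exact.
    have dsinh := has_deriv_comp1 (f := fun t => F t + r) (is_derive_sinh _) dp.
    have sinhE t : I t -> sinh (F t + r) = (-1) ^+ sg * c.
      by move=> It; rewrite -(cst t It) ratio// signrMK.
    have d0 : has_deriv I (fun t => sinh (F t + r)) s 0.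
      apply: has_deriv_near_eq (has_deriv_cst I s ((-1) ^+ sg * c)).
        by rewrite near_withinE; apply: nearW => t It; rewrite sinhE.
      by rewrite sinhE//; exact: si.1.
    have /eqP := has_deriv_unique itvI si.1 dsinh d0.
    by rewrite mulf_eq0 gt_eqF ?cosh_gt0//= => /eqP.
  have [[_ _ w0] _] := sys s si.1.
  by rewrite torse// w0 f0 mul0r oppr0 !scale0r addr0.
Qed.
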